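(* Let $\Theta$ be the Schottky group of a multiply connected circular domain $D_\zeta$ with $M\ge1$ holes, let $\zeta,\alpha\in D_\zeta$ with $\zeta\ne\alpha$, and let $C>0$, $\delta\in(0,2)$ be the constants of Pollicott's counting theorem, so that $$\mathrm{Card}\{\theta\in\Theta\setminus\{\mathrm{Id}\}:|R_{\zeta,\alpha}(\theta)-1|\ge1/T\}\sim C\,T^{\delta}\qquad(T\to\infty),$$ where $\delta$ is the Hausdorff dimension of the limit set of $\Theta$. Let $G$ be the finite weighted directed graph with edge weights $\Delta_{j,k}^{\mathrm{lb}}(\zeta,\alpha)$ and let $W_{\min}$ be its minimum walk weight (all notation, and the enumeration algorithm, as in the context). Suppose $G$ contains no negative cycle. Then, for every cutoff $U_{\max}>0$, the enumeration algorithm with input $\zeta,\alpha,U_{\max}$ and these edge weights returns every $\theta\in\Theta''_{\le U_{\max}}$ exactly once, and the number of words it visits is $O\big(e^{\delta(U_{\max}-W_{\min})}\big)$ as $U_{\max}\to\infty$.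
   Context: Domain. Fix $M\ge1$. Let $D_0=\{|z|<1\}$ and, for $m=1,\dots,M$, $D_m=\{z\in\mathbb{C}:|z-\delta_m|<q_m\}$ with $\delta_m\in\mathbb{C}$, $q_m>0$, $C_m=\partial D_m$. Assume $\overline{D_i}\cap\overline{D_j}=\emptyset$ for $i\ne j$ and $\overline{D_i}\subset D_0$ for all $i$. Put $D_\zeta=D_0\setminus\bigcup_{m=1}^M\overline{D_m}$ (just the name of the domain). Möbius maps. For $m=1,\dots,M$, $\theta_m(z)=\delta_m+\dfrac{q_m^2z}{1-\overline{\delta_m}z}$, acting on the Riemann sphere, $\theta_{-m}=\theta_m^{-1}$, and $C_{-m}=\theta_{-m}(C_m)$ (a circle on the Riemann sphere). Schottky group. $\Theta$ is the free group generated by $\theta_1,\dots,\theta_M$ under composition. Every non-identity element is uniquely a reduced word $\theta_{j_\ell}\cdots\theta_{j_1}$ with $\ell\ge1$, $j_i\in\{\pm1,\dots,\pm M\}$, $j_{i+1}\ne-j_i$ (rightmost factor acts first). $\Theta''=(\Theta\setminus\{\mathrm{Id}\})/\!\sim$ with $\theta\sim\theta^{-1}$; it is identified with the set containing, from each pair $\{\theta,\theta^{-1}\}$, the representative whose index sequence is lexicographically smaller. Potential. For $\theta\in\Theta\setminus\{\mathrm{Id}\}$, $$R_{\zeta,\alpha}(\theta)=\frac{(\theta(\zeta)-\alpha)(\theta(\alpha)-\zeta)}{(\theta(\zeta)-\zeta)(\theta(\alpha)-\alpha)},\qquad U(\theta)=U_{\zeta,\alpha}(\theta)=-\log|R_{\zeta,\alpha}(\theta)-1|,$$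 and $\Theta''_{\le U_{\max}}=\{\theta\in\Theta'':U(\theta)\le U_{\max}\}$. Edge weights. Let $R(a,b,c,d)=\dfrac{(c-a)(d-b)}{(c-b)(d-a)}$ (all cross-ratio expressions extended by continuity at $\infty$). For each $k$ pick either fixed point $z_k^{\mathrm{fix}}\in\mathbb{C}\cup\{\infty\}$ of $\theta_k$ and set $R_k(w;x)=R(w,z_k^{\mathrm{fix}},\theta_k^{-1}(x),x)$ for $x\in\{\zeta,\alpha\}$. For $j,k\in\{\pm1,\dots,\pm M\}$ with $k\neq-j$, $$\Delta_{j,k}^{\mathrm{lb}}=\Delta_{j,k}^{\mathrm{lb}}(\zeta,\alpha)=-\log|\theta_k'(z_k^{\mathrm{fix}})|+\min_{w\in C_j}\log|R_k(w;\zeta)|+\min_{w\in C_j}\log|R_k(w;\alpha)|,$$ where $\theta_k'(z_k^{\mathrm{fix}})$ is the derivative of $\theta_k$ at the fixed point (in the local coordinate $1/z$ if the fixed point is $\infty$). Graph. $G$ has vertex set $\{\theta_{-M},\dots,\theta_{-1},\theta_1,\dots,\theta_M\}$, a directed edge $\theta_j\to\theta_k$ for every pair with $k\ne-j$ (self-loops included), and weight $\Delta_{j,k}^{\mathrm{lb}}$ on that edge. A negative cycle is a directed cycle of negative total weight. The minimum walk weight $W_{\min}$ is the minimum of the total edge weight over all walks in $G$, including the empty walk of weight $0$ (so $W_{\min}\le0$, and $W_{\min}$ is finite when $G$ has no negative cycle). Enumeration algorithm (input $\zeta,\alpha$, cutoff $U_{\max}>0$, weights $\Delta_{j,k}^{\mathrm{lb}}$).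 Compute $W_{\min}$ by the Bellman–Ford algorithm, aborting if $G$ has a negative cycle. Initialize a stack $S=[\mathrm{Id}]$, an empty output list $\mathcal{O}$, and $\omega=\zeta-\alpha$. While $S$ is non-empty: pop $\theta$ from $S$ and set $K=\emptyset$. If $\theta=\mathrm{Id}$, set $K=\{\pm1,\dots,\pm M\}$. Otherwise, write $\theta=\theta_{j_\ell}\cdots\theta_{j_1}$ in reduced form and compute $U(\theta)$; if $U(\theta)\le U_{\max}-W_{\min}$, then (i) if moreover $U(\theta)\le U_{\max}$ and $\theta\in\Theta''$, append $\theta$ to $\mathcal{O}$ and replace $\omega$ by $\omega\cdot R_{\zeta,\alpha}(\theta)$, and (ii) set $K=\{k\in\{\pm1,\dots,\pm M\}:k\ne-j_\ell\}$. Finally push $\theta_k\theta$ onto $S$ for every $k\in K$. When $S$ is empty, return $\mathcal{O}$ and $\omega$. The words visited are the elements popped from $S$. Pollicott's counting theorem (a cited known result) asserts the existence of $C>0$ and $\delta\in(0,2)$ with the asymptotic stated in the claim. *)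

(* Defs.v *)
From HB Require Import structures.
From mathcomp Require Import all_boot all_order all_algebra.
From mathcomp Require Import all_classical all_reals all_analysis.
From mathcomp Require Import complex finmap ring.
From Stdlib Require Export Relation_Operators.

Set Implicit Arguments.
Unset Strict Implicit.
Unset Printing Implicit Defensive.

Import Order.TTheory GRing.Theory Num.Theory numFieldNormedType.Exports.

Local Open Scope classical_set_scope.
Local Open Scope ring_scope.
Local Open Scope complex_scope.

Section Sphere.
Variable R : realType.

(* [None] is the point at infinity.  The type [R[i]^o] is [R[i]] seen as a
   normed module over itself, which is what gives it its topology. *)
Definition sphere := one_point_compactification R[i]^o.

Definition infty : sphere := None.
Definition fin (z : R[i]) : sphere := Some z.

(* The default value is irrelevant wherever [to_complex] is used below: it is
   only ever applied near a point with finite image. *)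
Definition to_complex (z : sphere) : R[i] := if z is Some w then w else 0.

Definition modulus (z : R[i]) : R := ComplexField.Normc.normc z.

(* Difference of two points of the sphere in homogeneous coordinates:
   z = (z, 1) and infty = (1, 0), and [sdiff] is the 2 x 2 determinant.  In a
   quotient of products of [sdiff]s where every point occurs once above and
   once below, the result does not depend on the choice of coordinates, so it
   is the extension by continuity of the formula for finite points. *)
Definition sdiff (z w : sphere) : R[i] :=
  match z, w with
  | Some a, Some b => a - b
  | None, Some _ => 1
  | Some _, None => - 1
  | None, None => 0
  end.

Definition cross_ratio (a b c d : sphere) : R[i] :=
  (sdiff c a * sdiff d b) / (sdiff c b * sdiff d a).

Definition sinv (z : sphere) : sphere :=
  if z is Some w then if w == 0 then infty else fin w^-1 else fin 0.

(* Derivative of [f] at one of its fixed points [z], in the coordinate [1/z]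
   when the fixed point is infinity. *)
Definition fix_deriv (f : sphere -> sphere) (z : sphere) : R[i] :=
  if z is Some w then
    derive1 (fun t : R[i] => to_complex (f (fin t)) : R[i]^o) w
  else
    derive1 (fun t : R[i] => to_complex (sinv (f (sinv (fin t)))) : R[i]^o) 0.

Definition chordal (z w : sphere) : R :=
  match z, w with
  | Some a, Some b =>
      2 * modulus (a - b)
        / (Num.sqrt (1 + modulus a ^+ 2) * Num.sqrt (1 + modulus b ^+ 2))
  | Some a, None | None, Some a => 2 / Num.sqrt (1 + modulus a ^+ 2)
  | None, None => 0
  end.

(* [chordal] is at most 2, so this real supremum is the diameter. *)
Definition diameter (A : set sphere) : R :=
  sup [set chordal z w | z in A & w in A].

Definition hausdorff_content (s r : R) (A : set sphere) : \bar R :=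
  ereal_inf [set (\sum_(0 <= n <oo) (diameter (F n) `^ s)%:E)%E | F in
    [set F : nat -> set sphere |
      A `<=` \bigcup_n F n /\ forall n, diameter (F n) <= r]].

Definition hausdorff_measure (s : R) (A : set sphere) : \bar R :=
  ereal_sup [set hausdorff_content s r A | r in [set r : R | 0 < r]].

Definition hausdorff_dim (A : set sphere) : \bar R :=
  ereal_inf [set s%:E | s in [set s : R |
    0 < s /\ hausdorff_measure s A = 0%E]].

End Sphere.

(* The index m + 1 (resp. - (m + 1)) is encoded as (false, m) (resp.
   (true, m)) with m : 'I_M. *)
Definition letter (M : nat) : Type := (bool * 'I_M)%type.

Section Letters.
Variable M : nat.

Definition opp_letter (j : letter M) : letter M := (~~ j.1, j.2).

Definition index (j : letter M) : int :=
  if j.1 then - (j.2.+1)%:Z else (j.2.+1)%:Z.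

(* [allowed j k] says that k <> - j: the directed edges of the graph. *)
Definition allowed (j k : letter M) : bool := k != opp_letter j.

(* The word [:: j_l; ...; j_1] stands for the composite
   theta_{j_l} ... theta_{j_1}, in which theta_{j_1} acts first. *)
Definition word := seq (letter M).

Definition reduced (w : word) : bool :=
  sorted (fun k j => allowed j k) w.

Definition inv_word (w : word) : word := rev (map opp_letter w).

Definition index_seq (w : word) : seqlexi int := map index w.

(* Among w and its inverse, w has the lexicographically smaller index
   sequence. *)
Definition canonical (w : word) : bool :=
  (index_seq w < index_seq (inv_word w))%O.

End Letters.

Section WeightedGraph.
Variables (R : realType) (M : nat) (wt : letter M -> letter M -> R).

Definition walk_weight (s : seq (letter M)) : R :=
  \sum_(e <- zip s (behead s)) wt e.1 e.2.

Definition cycle_weight (s : seq (letter M)) : R :=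
  \sum_(e <- zip s (rot 1 s)) wt e.1 e.2.

Definition has_negative_cycle : Prop :=
  exists s : seq (letter M),
    [/\ s != [::], ucycle (@allowed M) s & cycle_weight s < 0].

(* The vertex sequence [::] is the empty walk.  The infimum is attained when
   there is no negative cycle. *)
Definition min_walk_weight : R :=
  inf [set walk_weight s | s in [set s | sorted (@allowed M) s]].

(* Bellman-Ford from a virtual source joined to all the 2M vertices by edges
   of weight 0.  A shortest path from the source has at most 2M edges, so that
   2M - 1 rounds of relaxation suffice after the initialization; a further
   improvement after 2M rounds reveals a negative cycle. *)
Definition relax (d : {ffun letter M -> R}) : {ffun letter M -> R} :=
  [ffun k => \big[Num.min/d k]_(j | allowed j k) (d j + wt j k)].

Definition bellman_ford : option R :=
  let d := iter (2 * M) relax [ffun=> 0] in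
  if relax d == d then Some (\big[Num.min/0]_k d k) else None.

End WeightedGraph.

Section Schottky.
Variables (R : realType) (M : nat) (delta : 'I_M -> R[i]) (q : 'I_M -> R).

Definition closed_disk (m : 'I_M) : set R[i] :=
  [set z | modulus (z - delta m) <= q m].

Definition unit_disk : set R[i] := [set z | modulus z < 1].

Definition circular_domain : Prop :=
  [/\ forall m, 0 < q m,
      forall i j, i != j -> closed_disk i `&` closed_disk j = set0 &
      forall i, closed_disk i `<=` unit_disk].

Definition D_zeta : set R[i] := unit_disk `\` \bigcup_m closed_disk m.

Definition theta_pos (m : 'I_M) (z : sphere R) : sphere R :=
  let dl := delta m in let dc := dl^*%C in let q2 := (q m ^+ 2)%:C in
  if z is Some x then
    if 1 - dc * x == 0 then infty R else fin (dl + q2 * x / (1 - dc * x))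
  else if dl == 0 then infty R else fin (dl - q2 / dc).

(* The inverse of [theta_pos m]: see [theta_posK] and [theta_negK]. *)
Definition theta_neg (m : 'I_M) (z : sphere R) : sphere R :=
  let dl := delta m in let dc := dl^*%C in let q2 := (q m ^+ 2)%:C in
  if z is Some x then
    if q2 + dc * (x - dl) == 0 then infty R
    else fin ((x - dl) / (q2 + dc * (x - dl)))
  else if dl == 0 then infty R else fin dc^-1.

Definition theta (k : letter M) : sphere R -> sphere R :=
  if k.1 then theta_neg k.2 else theta_pos k.2.

Lemma theta_posK m : 0 < q m -> cancel (theta_pos m) (theta_neg m).
Proof.
move=> q0; have q2_neq0 : (q m ^+ 2)%:C != 0 :> R[i].
  by rewrite (inj_eq (@complexI R)) expf_neq0 // gt_eqF.
have conj_neq0 (z : R[i]) : z != 0 -> z^*%C != 0.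
  by apply: contra_neq => z0; rewrite -(conjcK z) z0 conjc0.
rewrite /theta_pos /theta_neg => -[x|] /=; last first.
  case: (eqVneq (delta m) 0) => [|d0] /=; first by [].
  rewrite addrAC subrr sub0r mulrN mulrCA divff ?conj_neq0 // mulr1 subrr eqxx.
  by [].
set dl := delta m; set dc := dl^*%C; set q2 := (q m ^+ 2)%:C.
case: eqP => [x0|/eqP x0] /=.
  have dc0 : dc != 0.
    by apply: contra_eq_neq x0 => ->; rewrite mul0r subr0 oner_neq0.
  case: eqP => [dl0|_]; first by rewrite /dc dl0 conjc0 eqxx in dc0.
  congr Some; apply: (mulfI dc0); rewrite divff //.
  by apply/eqP; rewrite -subr_eq0; apply/eqP.
rewrite addrAC subrr add0r.
have -> : q2 + dc * (q2 * x / (1 - dc * x)) = q2 / (1 - dc * x).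
  by field.
rewrite mulf_eq0 invr_eq0 (negPf x0) (negPf q2_neq0) /=.
rewrite -/q2 in q2_neq0; clearbody dc q2.
by congr Some; field; rewrite x0 q2_neq0.
Qed.

Lemma theta_negK m : 0 < q m -> cancel (theta_neg m) (theta_pos m).
Proof.
move=> q0; have q2_neq0 : (q m ^+ 2)%:C != 0 :> R[i].
  by rewrite (inj_eq (@complexI R)) expf_neq0 // gt_eqF.
have conj_neq0 (z : R[i]) : z != 0 -> z^*%C != 0.
  by apply: contra_neq => z0; rewrite -(conjcK z) z0 conjc0.
rewrite /theta_pos /theta_neg => -[x|] /=; last first.
  case: (eqVneq (delta m) 0) => [|d0] /=; first by [].
  by rewrite divff ?conj_neq0 // subrr eqxx.
set dl := delta m; set dc := dl^*%C; set q2 := (q m ^+ 2)%:C.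
case: eqP => [x0|/eqP x0] /=.
  have dc0 : dc != 0.
    by apply: contra_eq_neq x0 => ->; rewrite mul0r addr0.
  case: eqP => [dl0|_]; first by rewrite /dc dl0 conjc0 eqxx in dc0.
  congr Some; apply: (mulfI dc0); rewrite mulrBr mulrCA divff // mulr1.
  clearbody dc q2; have -> : q2 = - (dc * (x - dl)).
    by apply/eqP; rewrite -addr_eq0; apply/eqP.
  by ring.
rewrite -/q2 in q2_neq0; clearbody dc q2.
have -> : 1 - dc * ((x - dl) / (q2 + dc * (x - dl)))
    = q2 / (q2 + dc * (x - dl)) by field.
rewrite mulf_eq0 invr_eq0 (negPf x0) (negPf q2_neq0) /=.
by congr Some; field; rewrite x0 q2_neq0.
Qed.

Definition circle (k : letter M) : set (sphere R) :=
  let C := [set fin z | z in [set z | modulus (z - delta k.2) = q k.2]] in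
  if k.1 then theta k @` C else C.

Definition act (w : word M) : sphere R -> sphere R :=
  foldr (fun k f => theta k \o f) id w.

(* The elements of the Schottky group are maps of the sphere; the group
   generated by the theta_m is the set of all composites of the theta_{+-m}. *)
Definition Theta : set (sphere R -> sphere R) := range act.

Definition limit_set : set (sphere R) :=
  \bigcup_z limit_point [set f z | f in Theta].

Variables zeta alpha : R[i].

Definition R_pot (f : sphere R -> sphere R) : R[i] :=
  let z := fin zeta in let a := fin alpha in
  (sdiff (f z) a * sdiff (f a) z) / (sdiff (f z) z * sdiff (f a) a).

Definition U_pot (f : sphere R -> sphere R) : R :=
  - ln (modulus (R_pot f - 1)).

(* The number of theta in Theta \ {Id} with |R(theta) - 1| >= 1 / T.  The
   cardinal [#|` fset_set A|] of an infinite set A is 0 by convention, so a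
   count equivalent to C T ^ d with C > 0 forces finiteness for large T. *)
Definition pollicott_count (T : R) : nat :=
  #|` fset_set [set f | [/\ Theta f, f <> id &
                          T^-1 <= modulus (R_pot f - 1)]]|.

Definition Theta'' : set (sphere R -> sphere R) :=
  [set act w | w in [set w | [/\ w != [::], reduced w & canonical w]]].

Definition Theta''_le (Umax : R) : set (sphere R -> sphere R) :=
  [set f | Theta'' f /\ U_pot f <= Umax].

(* [zfix k] is the chosen fixed point of theta_k. *)
Variable zfix : letter M -> sphere R.

Definition R_edge (k : letter M) (w : sphere R) (x : R[i]) : R[i] :=
  cross_ratio w (zfix k) (theta (opp_letter k) (fin x)) (fin x).

(* Both infima are minima: the circle is compact and, when k <> - j, the
   continuous function |R_k(.; x)| has neither zero nor pole on it. *)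
Definition Delta_lb (j k : letter M) : R :=
  - ln (modulus (fix_deriv (theta k) (zfix k)))
  + inf [set ln (modulus (R_edge k w zeta)) | w in circle j]
  + inf [set ln (modulus (R_edge k w alpha)) | w in circle j].

End Schottky.

Section Enumeration.
Variables (R : realType) (M : nat) (delta : 'I_M -> R[i]) (q : 'I_M -> R).
Variables (zeta alpha : R[i]) (Umax : R) (wt : letter M -> letter M -> R).

Local Notation act := (act delta q).
Local Notation U w := (U_pot zeta alpha (act w)).

Record state := State {
  stack : seq (word M);
  output : seq (word M);
  omega : R[i];
  visited : seq (word M) }.

Definition init_state : state := State [:: [::]] [::] (zeta - alpha) [::].

Definition next_letters (W : R) (w : word M) : pred (letter M) :=
  fun k => if w is j :: _ then (U w <= Umax - W) && allowed j k else true.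

Definition emitted (W : R) (w : word M) : bool :=
  [&& w != [::], U w <= Umax - W, U w <= Umax & canonical w].

(* One iteration of the loop, when Bellman-Ford has returned W.  The order ks
   in which the words theta_k theta are pushed is left unspecified. *)
Inductive step (W : R) : state -> state -> Prop :=
| Step w S O om V ks of perm_eq ks (enum (next_letters W w)) :
    step W (State (w :: S) O om V)
      (State ([seq k :: w | k <- ks] ++ S)
             (if emitted W w then rcons O w else O)
             (if emitted W w then om * R_pot zeta alpha (act w) else om)
             (rcons V w)).

(* The algorithm does not abort and its loop stops, whatever the orders in
   which the words are pushed. *)
Definition terminates : Prop :=
  exists2 W, bellman_ford wt = Some W &
    Acc (fun s' s => step W s s') init_state.

Definition returns (s : state) : Prop :=
  exists2 W, bellman_ford wt = Some W &
    clos_refl_trans state (step W) init_state s /\ stack s = [::].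

End Enumeration.

(* Main.v *)
Require Import Defs.
From mathcomp Require Import all_boot all_order all_algebra.
From mathcomp Require Import all_classical all_reals all_analysis.
From mathcomp Require Import complex finmap ring lra.

Set Implicit Arguments.
Unset Strict Implicit.
Unset Printing Implicit Defensive.

Import Order.TTheory GRing.Theory Num.Theory numFieldNormedType.Exports.

Local Open Scope classical_set_scope.
Local Open Scope ring_scope.
Local Open Scope complex_scope.

(** The enumeration explores the tree of reduced words, in which the children
    of a word [theta] are the words [theta_k theta], and it prunes a branch as
    soon as [U] exceeds [Umax - Wmin].  Nothing is lost because [U] can never
    drop by more than [- Wmin] along a branch, and little is visited because
    the nonempty words which it expands all satisfy [U <= Umax - Wmin].

    The first claim comes from an exact formula.  The number [R(theta) - 1] is
    the cross ratio [pair_ratio a b] of [zeta], [alpha] and their images [a],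
    [b] under [theta].  Pulling [zeta] and [alpha] back by [theta_k] instead of
    pushing [a] and [b] forward gives ([pair_ratio_theta])
      [U (theta_k theta) - U theta
         = - ln |theta_k'(z_k)| + ln |R_k(a; zeta)| + ln |R_k(b; alpha)|],
    [z_k] being the chosen fixed point.  If [theta] has first letter [j], a
    ping-pong argument places [a] and [b] in the disc bounded by [C_j], while
    the zero and the pole of [R_k(.; zeta)] and [R_k(.; alpha)] lie outside it.
    By the minimum principle ([circle_crossing]) the last two terms are
    therefore at least their minima over [C_j], and [U] increases by at least
    the weight of the edge from [j] to [k] ([U_edge_increment]).  The letters
    added to a word spell a walk in the graph, whose weight is at least [Wmin],
    so no word below the cutoff has an ancestor which was pruned
    ([below_cutoff_reachable]); an invariant of the search shows that it pops
    the words reachable without pruning, each of them once ([search_result]).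
    Ping-pong also shows that distinct reduced words are distinct maps
    ([act_reduced_inj]), so that no map is returned twice.

    Bellman-Ford computes [Wmin] because, without negative cycles, removing
    the cycles from a walk does not increase its weight, so that walks without
    repeated vertices suffice ([bellman_ford_min]).

    For the number of visited words, each of them is empty or a child of the
    empty word or of a word with [U <= Umax - Wmin].  By freeness these parents
    are at most as many as the maps with [|R - 1| >= exp (Wmin - Umax)], which
    the counting asymptotics bounds by [2 C exp (d (Umax - Wmin))].  That
    asymptotics also contains the finiteness of the set of such maps, hence the
    termination of the search. *)

(** * Walks and Bellman-Ford *)

Section MinimumWalk.
Variables (R : realType) (M : nat) (wt : letter M -> letter M -> R).
Implicit Types (s p : seq (letter M)) (k : letter M).

Local Notation walk := (sorted (@allowed M)).
Local Notation weight := (walk_weight wt).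

Lemma walk_weight_nil : weight [::] = 0.
Proof. by rewrite /walk_weight big_nil. Qed.

Lemma walk_weight1 k : weight [:: k] = 0.
Proof. by rewrite /walk_weight big_nil. Qed.

Lemma walk_weight_cons j k s : weight (j :: k :: s) = wt j k + weight (k :: s).
Proof. by rewrite /walk_weight big_cons. Qed.

Lemma walk_weight_cat s k p :
  weight (s ++ k :: p) = weight (rcons s k) + weight (k :: p).
Proof.
elim: s => [|a [|b s] IHs] /=; first by rewrite walk_weight1 add0r.
  by rewrite !walk_weight_cons walk_weight1 addr0.
by rewrite !walk_weight_cons -addrA; congr (_ + _); exact: IHs.
Qed.

Lemma walk_weight_rcons j p k :
  weight (rcons (j :: p) k) = weight (j :: p) + wt (last j p) k.
Proof.
rewrite lastI -cats1 cat_rcons walk_weight_cat walk_weight_cons walk_weight1.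
by rewrite addr0.
Qed.

(** The closing edge of a cycle is the last edge of the walk which returns to
    the starting vertex. *)
Lemma cycle_weightE k p : cycle_weight wt (k :: p) = weight (k :: rcons p k).
Proof.
rewrite /cycle_weight /walk_weight rot1_cons /=.
suff zipE (x : letter M) (s t : seq (letter M)) : size s = size t ->
  zip (rcons s x) t = zip s t.
  by rewrite -[k :: rcons p k]/(rcons (k :: p) k) zipE //= size_rcons.
by elim: s t => [|a s IHs] [|b t] //= [/IHs ->].
Qed.

Lemma walk_rcons j p k :
  walk (rcons (j :: p) k) = walk (j :: p) && allowed (last j p) k.
Proof. by rewrite /= rcons_path. Qed.

Section NoNegativeCycle.
Hypothesis no_neg : ~ has_negative_cycle wt.

Lemma simple_cycle_ge0 k p :
  walk (k :: rcons p k) -> uniq (k :: p) -> 0 <= weight (k :: rcons p k).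
Proof.
move=> cyc un; rewrite leNgt; apply/negP => lt0; apply: no_neg.
by exists (k :: p); split; rewrite ?cycle_weightE // /ucycle un andbT.
Qed.

(** Shortcutting: a repeated vertex closes a simple cycle, whose removal cannot
    increase the weight.  Recursing from the last vertex ensures that the part
    of the walk behind the current vertex is already simple, so the cycle cut
    out is simple too: only simple cycles are known not to be negative. *)
Lemma walk_shorten j p : walk (j :: p) ->
  exists2 p', [/\ walk (j :: p'), uniq (j :: p') & last j p' = last j p]
            & weight (j :: p') <= weight (j :: p).
Proof.
elim: p j => [|k p IHp] j; first by exists [::].
move=> /= /andP[jk /IHp[p' [wp' up' lp'] le_p']].
have le2 : weight [:: j, k & p'] <= weight [:: j, k & p].
  by rewrite !walk_weight_cons lerD2l.
have [jp'|njp'] := boolP (j \in k :: p'); last first.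
  by exists (k :: p') => //; split=> //=; rewrite ?jk ?njp'.
case/splitPr E: _ / jp' => [s t].
have wjs : walk (j :: s ++ j :: t) by rewrite -E /= jk.
have us : uniq (s ++ j :: t) by rewrite -E.
exists t; first split.
- by move: wjs; rewrite -cat_cons => /cat_sorted2[].
- by move: us; rewrite cat_uniq => /and3P[].
- by rewrite -lp' -[last k p']/(last j (k :: p')) E last_cat.
apply: le_trans le2; rewrite E -cat_cons walk_weight_cat lerDr rcons_cons.
apply: simple_cycle_ge0.
  by move: wjs; rewrite -cat_rcons /= cat_path => /andP[].
by move: us; rewrite -cat_rcons cat_uniq rcons_uniq => /andP[]/=.
Qed.

Lemma walk_simple j p : walk (j :: p) ->
  exists2 p', [/\ walk (j :: p'), (size p' < 2 * M)%N & last j p' = last j p]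
            & weight (j :: p') <= weight (j :: p).
Proof.
move=> /walk_shorten[p' [wp' up' lp'] le]; exists p' => //; split=> //.
have := max_card (mem (j :: p')).
by rewrite (card_uniqP up') card_prod card_bool card_ord.
Qed.

End NoNegativeCycle.

(** ** Bellman-Ford *)

Local Notation dist n := (iter n (relax wt) [ffun=> 0]).

Lemma relaxE (d : {ffun letter M -> R}) k :
  relax wt d k = d k \/
  exists2 j, allowed j k & relax wt d k = d j + wt j k.
Proof.
rewrite ffunE.
elim/big_ind: _ => [|x y IHx IHy|j jk]; [by left| |by right; exists j].
by rewrite /Num.min; case: ifP.
Qed.

Lemma relax_le (d : {ffun letter M -> R}) k : relax wt d k <= d k.
Proof. by rewrite ffunE bigmin_idl ge_min lexx. Qed.

Lemma relax_le_edge (d : {ffun letter M -> R}) j k : allowed j k ->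
  relax wt d k <= d j + wt j k.
Proof. by move=> jk; rewrite ffunE; exact: bigmin_le_cond. Qed.

(** Distances are weights of actual walks, which keeps them above the minimum
    walk weight, and [n] rounds bring them below the weights of all walks with
    at most [n] edges. *)
Lemma dist_attained n k :
  exists j p, [/\ walk (j :: p), last j p = k & dist n k = weight (j :: p)].
Proof.
elim: n k => [|n IHn] k /=.
  by exists k, [::]; split; rewrite ?ffunE ?walk_weight1.
case: (relaxE (dist n) k) => [->|[j jk ->]]; first exact: IHn.
have [i [p [wp lp ->]]] := IHn j; rewrite -lp in jk *.
exists i, (rcons p k); split; [|exact: last_rcons|].
  by rewrite rcons_path jk andbT.
by rewrite -rcons_cons walk_weight_rcons.
Qed.

Lemma dist_le n j p :
  walk (j :: p) -> (size p <= n)%N -> dist n (last j p) <= weight (j :: p).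
Proof.
elim: n p => [|n IHn] p wp sp.
  by move: sp; case: p wp => //= _ _; rewrite ffunE walk_weight1.
case/lastP: p wp sp => [|p k] wp sp.
  by apply: le_trans (relax_le _ _) _; exact: IHn.
move: wp sp; rewrite -rcons_cons walk_rcons size_rcons => /andP[wp jk] sp.
rewrite last_rcons walk_weight_rcons.
by apply: le_trans (relax_le_edge _ jk) _; rewrite lerD2r; exact: IHn.
Qed.

Section Correctness.
Hypothesis no_neg : ~ has_negative_cycle wt.

Lemma dist_minimal n j p : (2 * M <= n)%N -> walk (j :: p) ->
  dist n (last j p) <= weight (j :: p).
Proof.
move=> Mn /(walk_simple no_neg)[p' [wp' sp' <-] le]; apply: le_trans le.
by apply: dist_le => //; apply: leq_trans Mn; exact: ltnW.
Qed.

Let dmin := \big[Num.min/0]_k dist (2 * M) k.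

Lemma min_dist_attained :
  exists2 s, walk s & dmin = weight s.
Proof.
rewrite /dmin; elim/big_ind: _ => [|x y IHx IHy|k _].
- by exists [::]; rewrite ?walk_weight_nil.
- by rewrite /Num.min; case: ifP.
- by have [j [p [wp _ ->]]] := dist_attained (2 * M) k; exists (j :: p).
Qed.

Lemma min_dist_le s : walk s -> dmin <= weight s.
Proof.
case: s => [|j p] ws.
  by rewrite /dmin walk_weight_nil bigmin_idl ge_min lexx.
apply: le_trans (dist_minimal (leqnn _) ws).
by rewrite /dmin; exact: bigmin_le_cond.
Qed.

Lemma min_walk_weightE : min_walk_weight wt = dmin.
Proof.
have [s ws ds] := min_dist_attained.
have lb : lbound [set weight s | s in [set s | walk s]] dmin.
  by move=> _ [t wt_t <-]; exact: min_dist_le.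
apply/eqP; rewrite eq_le; apply/andP; split.
  by rewrite ds; apply: ge_inf; [exists dmin|exists s].
by apply: lb_le_inf => //; exists (weight s), s.
Qed.

Lemma min_walk_weight_le s : walk s -> min_walk_weight wt <= weight s.
Proof. by rewrite min_walk_weightE; exact: min_dist_le. Qed.

Lemma bellman_ford_min : bellman_ford wt = Some (min_walk_weight wt).
Proof.
rewrite /bellman_ford; case: eqP => [_|[]]; first by rewrite min_walk_weightE.
apply/ffunP => k; apply/eqP; rewrite eq_le relax_le /=.
have [j [p [wp lp dp]]] := dist_attained (2 * M).+1 k.
by move: dp => /= ->; rewrite -lp; exact: dist_minimal.
Qed.

End Correctness.
End MinimumWalk.

(** * The search *)

Section EnumerationCorrectness.
Variables (R : realType) (M : nat) (delta : 'I_M -> R[i]) (q : 'I_M -> R).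
Variables (zeta alpha : R[i]) (Umax W : R).
Implicit Types (w v : word M) (k j : letter M) (st : state R M).

Local Notation U w := (U_pot zeta alpha (act delta q w)).
Local Notation next := (next_letters delta q zeta alpha Umax W).
Local Notation emit := (emitted delta q zeta alpha Umax W).
Local Notation step := (step delta q zeta alpha Umax W).
Local Notation init := (init_state M zeta alpha).

(** Words grow on the left, so the tail of a word is its parent in the search
    tree. *)
Fixpoint reachable w : bool :=
  if w is k :: v then next v k && reachable v else true.

Lemma reachable_reduced w : reachable w -> reduced w.
Proof.
elim: w => [|k [|j w] IHw] //= /andP[nk rw].
by case/andP: nk => _ ->; exact: IHw.
Qed.

Lemma reachable_suffix s v : reachable (s ++ v) -> reachable v.
Proof. by elim: s => //= k s IHs /andP[_]. Qed.

(** The third clause, that parents of discovered words have been popped, is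
    what keeps the children of a popped word distinct from everything already
    discovered; the fourth becomes the completeness of the search when the
    stack is empty. *)
Definition search_invariant st : Prop :=
  [/\ uniq (stack st ++ visited st),
      {in stack st ++ visited st, forall w, reachable w},
      forall k w, k :: w \in stack st ++ visited st -> w \in visited st,
      forall w, reachable w -> w \in visited st \/
        exists s v, w = s ++ v /\ v \in stack st
    & output st = [seq w <- visited st | emit w]].

Lemma search_invariant_init : search_invariant init.
Proof.
split=> //=; first by move=> w; rewrite inE => /eqP ->.
by move=> w _; right; exists w, [::]; rewrite cats0 inE.
Qed.

Lemma search_invariant_step st st' :
  step st st' -> search_invariant st -> search_invariant st'.
Proof.
case=> w S O om V ks ks_next [/= /andP[wSV uSV] reach par cover out].
have ksE k : (k \in ks) = next w k by rewrite (perm_mem ks_next) mem_enum.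
have w_reach : reachable w by apply: reach; rewrite inE eqxx.
have rassoc : w :: S ++ V =i S ++ rcons V w.
  by move=> v; rewrite inE !mem_cat mem_rcons inE orbCA.
have inE' v : v \in ([seq k :: w | k <- ks] ++ S) ++ rcons V w ->
    v \in [seq k :: w | k <- ks] \/ v \in w :: S ++ V.
  by rewrite -catA mem_cat rassoc => /orP.
split=> /=.
- rewrite -catA cat_uniq map_inj_uniq => [|k k' [] //].
  rewrite (perm_uniq ks_next) enum_uniq /=; apply/andP; split; last first.
    rewrite (@perm_uniq _ _ (w :: S ++ V)) /= ?wSV //.
    by rewrite -cats1 catA perm_catC.
  apply/hasPn => v; rewrite -rassoc => vSV.
  apply/negP => /mapP[k _ E]; move: vSV; rewrite E => /par wV.
  by move: wSV; rewrite mem_cat wV orbT.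
- move=> v /inE'[/mapP[k kks ->]|/reach //].
  by rewrite /= -ksE kks.
- move=> k v /inE'[/mapP[k' _ [_ ->]]|/par vV].
    by rewrite mem_rcons inE eqxx.
  by rewrite mem_rcons inE vV orbT.
- move=> v rv; rewrite mem_rcons inE.
  case: (cover v rv) => [->|[s [u [E]]]]; first by left; rewrite orbT.
  rewrite inE => /orP[/eqP uw|uS]; last first.
    by right; exists s, u; rewrite mem_cat uS orbT.
  case/lastP: s E => [|s k] E; first by left; rewrite E uw eqxx.
  right; exists s, (k :: w); rewrite E uw cat_rcons; split=> //.
  rewrite mem_cat; apply/orP; left; apply/mapP; exists k => //.
  by move: rv; rewrite E uw cat_rcons ksE => /reachable_suffix /= /andP[].
- by rewrite filter_rcons out.
Qed.

Lemma search_invariant_trace st st' : clos_refl_trans _ step st st' ->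
  search_invariant st -> search_invariant st'.
Proof.
elim=> {st st'} [st st' /search_invariant_step|//|st1 st2 st3 _ IH1 _ IH2 inv].
  by [].
exact/IH2/IH1.
Qed.

Lemma search_result st : clos_refl_trans _ step init st -> stack st = [::] ->
  [/\ uniq (visited st), forall w, (w \in visited st) = reachable w
    & output st = [seq w <- visited st | emit w]].
Proof.
move=> /search_invariant_trace /(_ search_invariant_init).
move=> [un reach _ cover out] S0.
rewrite S0 /= in un reach cover; split=> // w; apply/idP/idP => [/reach //|].
by case/cover => // -[s [v []]].
Qed.

(** ** Termination *)

(** If words longer than [n] fail the test, the search tree is finite.  A word
    of length [l] is given the weight (2M + 1) ^ (n + 1 - l), which exceeds the
    total weight of its at most 2M children. *)
Definition search_measure (n : nat) st : nat :=
  \sum_(w <- stack st) (2 * M).+1 ^ (n.+1 - size w).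

Lemma search_measure_decreases n st st' :
  (forall w, reduced w -> (n < size w)%N -> Umax - W < U w) ->
  {in stack st, forall w, reachable w} -> step st st' ->
  (search_measure n st' < search_measure n st)%N.
Proof.
move=> long stR stst'; case: stst' stR => w S O om V ks ks_next /= stR.
rewrite /search_measure /= big_cat big_cons /= ltn_add2r big_map.
have [small|big] := leqP (size w) n; last first.
  have wR : reduced w by apply: reachable_reduced; apply: stR; rewrite inE eqxx.
  have -> : ks = [::].
    apply: size0nil; rewrite (perm_size ks_next) -cardE; apply: eq_card0 => k.
    rewrite unfold_in /next_letters; case: (w) big wR => // j v big wR.
    by rewrite leNgt long.
  by rewrite big_nil expn_gt0.
rewrite subSn // expnS (eq_bigr (fun=> (2 * M).+1 ^ (n - size w))%N) //.
rewrite big_const_seq count_predT iter_addn_0 mulnC.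
rewrite ltn_pmul2r ?expn_gt0 // ltnS (perm_size ks_next) -cardE.
by apply: leq_trans (max_card _) _; rewrite card_prod card_bool card_ord.
Qed.

Lemma search_terminates n :
  (forall w, reduced w -> (n < size w)%N -> Umax - W < U w) ->
  Acc (fun st' st => step st st') init.
Proof.
move=> long.
suff acc m st : (search_measure n st < m)%N -> search_invariant st ->
    Acc (fun st' st => step st st') st.
  exact: acc (ltnSn _) search_invariant_init.
elim: m st => [|m IHm] st; first by rewrite ltn0.
move=> stm inv; constructor => st' stst'.
apply: IHm (search_invariant_step stst' inv).
rewrite -ltnS; apply: leq_trans stm; rewrite ltnS.
apply: search_measure_decreases stst' => // w wS.
by case: inv => _ reach _ _ _; apply: reach; rewrite mem_cat wS.
Qed.

(** A popped word is the empty word, or extends by one of the 2M letters the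
    empty word or a reduced word which has passed the test. *)
Lemma size_visited (L : seq (word M)) st :
  (forall w, w != [::] -> reduced w -> U w <= Umax - W -> w \in L) ->
  clos_refl_trans _ step init st -> stack st = [::] ->
  (size (visited st) <= 1 + 2 * M * (1 + size L))%N.
Proof.
move=> LP run S0; have [un visE _] := search_result run S0.
pose P := [seq k :: w | k <- enum {: letter M}, w <- [::] :: L].
have <- : size P = (2 * M * (1 + size L))%N.
  by rewrite size_allpairs -cardE card_prod card_bool card_ord.
rewrite -[(1 + size P)%N]/(size ([::] :: P)); apply: uniq_leq_size un _ => w.
rewrite visE inE; case: w => [|k w] //= /andP[nw rw].
apply: (allpairs_f (@cons (letter M))); first exact: mem_enum.
case: w nw rw => // j w /andP[Uw _] rw; rewrite inE LP //.
exact: reachable_reduced.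
Qed.

(** ** Completeness *)

Section Completeness.
Variable wt : letter M -> letter M -> R.
Hypothesis W_le : forall s, sorted (@allowed M) s -> W <= walk_weight wt s.
Hypothesis U_edge : forall j k w, reduced [:: k, j & w] ->
  U (j :: w) + wt j k <= U [:: k, j & w].

(** The letters [rev s] added to the word spell a walk in the graph; the
    increments along its edges telescope. *)
Lemma U_walk s j w : reduced (s ++ j :: w) ->
  sorted (@allowed M) (j :: rev s) /\
  U (j :: w) + walk_weight wt (j :: rev s) <= U (s ++ j :: w).
Proof.
elim: s => [|k s IHs]; first by rewrite walk_weight1 addr0.
move=> red; have {}IHs := IHs (path_sorted red).
case: IHs => [ws le_s].
rewrite rev_cons -rcons_cons walk_rcons walk_weight_rcons.
have lastE : exists v, s ++ j :: w = last j (rev s) :: v.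
  case: (s) => [|i s']; first by exists w.
  by exists (s' ++ j :: w); rewrite rev_cons last_rcons.
case: lastE => v E; move: red le_s; rewrite cat_cons E => red le_s; split.
  by rewrite ws; case/andP: red.
by rewrite addrA (le_trans _ (U_edge red)) // lerD2r.
Qed.

(** The walk from a suffix to the whole word weighs at least [W], so a suffix of
    a word below the cutoff [Umax] cannot exceed [Umax - W]. *)
Lemma below_cutoff_reachable w : reduced w -> U w <= Umax -> reachable w.
Proof.
move=> red Uw; suff: forall s v, w = s ++ v -> reachable v.
  by move/(_ [::] w); apply.
move=> s v; elim: v s => [//|k v IHv] s E /=.
have E' : w = rcons s k ++ v by rewrite cat_rcons.
rewrite (IHv _ E') andbT; case: v {IHv} E' E => // j v E' E.
have /U_walk[ws le_w] : reduced (rcons s k ++ j :: v) by rewrite -E'.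
have := W_le ws; rewrite -E' in le_w => leW; apply/andP; split; first lra.
by move: red; rewrite E => /cat_sorted2[_ /= /andP[]].
Qed.

Lemma mem_output st w : W <= 0 ->
  clos_refl_trans _ step init st -> stack st = [::] ->
  (w \in output st) =
    [&& w != [::], reduced w, Defs.canonical w & U w <= Umax].
Proof.
move=> W0 run S0; have [_ visE ->] := search_result run S0.
rewrite mem_filter visE; apply/andP/and4P.
  by case=> /and4P[w0 _ Uw cw] /reachable_reduced rw; split.
case=> w0 rw cw Uw; rewrite below_cutoff_reachable //; split=> //.
by apply/and4P; split=> //; lra.
Qed.

End Completeness.
End EnumerationCorrectness.

(** * Homogeneous coordinates on the sphere *)

(* The modulus of a literal would otherwise unfold to a square root. *)
Arguments modulus : simpl never.

Section Modulus.
Variable R : realType.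
Implicit Types z w : R[i].

Lemma modulus0 : modulus (0 : R[i]) = 0.
Proof. exact: ComplexField.Normc.normc0. Qed.

Lemma modulus1 : modulus (1 : R[i]) = 1.
Proof. exact: ComplexField.Normc.normc1. Qed.

Lemma modulusM z w : modulus (z * w) = modulus z * modulus w.
Proof. exact: ComplexField.Normc.normcM. Qed.

Lemma modulusV z : modulus z^-1 = (modulus z)^-1.
Proof. exact: ComplexField.Normc.normcV. Qed.

Lemma modulusN z : modulus (- z) = modulus z.
Proof. exact: normcN. Qed.

Lemma modulus_ge0 z : 0 <= modulus z.
Proof. by case: z => a b; exact: sqrtr_ge0. Qed.

Lemma modulus_eq0 z : (modulus z == 0) = (z == 0).
Proof.
apply/eqP/eqP => [|->]; last exact: modulus0.
exact: ComplexField.Normc.eq0_normc.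
Qed.

Lemma modulus_gt0 z : (0 < modulus z) = (z != 0).
Proof. by rewrite lt_def modulus_ge0 andbT modulus_eq0. Qed.

Lemma modulus_sqr z : modulus z ^+ 2 = complex.Re z ^+ 2 + complex.Im z ^+ 2.
Proof. by case: z => a b; rewrite sqr_sqrtr // addr_ge0 ?sqr_ge0. Qed.

Lemma modulus_conj z : modulus z^*%C = modulus z.
Proof. by case: z => a b; rewrite /modulus /= sqrrN. Qed.

Lemma le_modulusD z w : modulus (z + w) <= modulus z + modulus w.
Proof. exact: le_normcD. Qed.

Lemma modulus_real (r : R) : 0 <= r -> modulus r%:C = r.
Proof. by move=> r0; rewrite /modulus /= expr0n addr0 sqrtr_sqr ger0_norm. Qed.

End Modulus.

Section Homogeneous.
Variable R : realType.
Implicit Types z w : sphere R.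

(** Every point of the sphere is written as a nonzero vector of homogeneous
    coordinates, for which [sdiff] is the determinant. *)
Definition coord1 z : R[i] := if z is Some a then a else 1.
Definition coord2 z : R[i] := if z is Some _ then 1 else 0.

Lemma sdiffE z w : sdiff z w = coord1 z * coord2 w - coord2 z * coord1 w.
Proof.
by case: z w => [a|] [b|] /=; rewrite ?mulr1 ?mul1r ?mulr0 ?mul0r ?subr0 ?sub0r.
Qed.

Lemma sdiff_eq0 z w : sdiff z w = 0 <-> z = w.
Proof.
split=> [|->]; last by rewrite sdiffE mulrC subrr.
case: z w => [a|] [b|] //= /eqP; rewrite ?subr_eq0 ?oppr_eq0 ?oner_eq0 //.
by move=> /eqP ->.
Qed.

Lemma sdiff_neq0 z w : z <> w -> sdiff z w != 0.
Proof. by move=> zw; apply/eqP => /sdiff_eq0. Qed.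

Lemma sdiffC z w : sdiff z w = - sdiff w z.
Proof. by rewrite !sdiffE; ring. Qed.

End Homogeneous.

Section Moebius.
Variables (R : realType) (M : nat) (delta : 'I_M -> R[i]) (q : 'I_M -> R).
Hypothesis q_gt0 : forall m, 0 < q m.
Implicit Types (z w p x : sphere R) (k j : letter M) (m : 'I_M).

Local Notation theta := (theta delta q).
Local Notation dl m := (delta m).
Local Notation dc m := ((delta m)^*%C).
Local Notation q2 m := ((q m ^+ 2)%:C : R[i]).

Lemma q2_neq0 m : q2 m != 0.
Proof. by rewrite (inj_eq (@complexI R)) expf_neq0 // gt_eqF. Qed.

Lemma thetaK k : cancel (theta k) (theta (opp_letter k)).
Proof.
by case: k => -[] m; [exact: theta_negK|exact: theta_posK].
Qed.

Lemma theta_oppK k : cancel (theta (opp_letter k)) (theta k).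
Proof.
by case: k => -[] m; [exact: theta_posK|exact: theta_negK].
Qed.

Lemma theta_inj k : injective (theta k).
Proof. exact: can_inj (thetaK k). Qed.

(** The linear lift of [theta k] to homogeneous coordinates: both matrices of
    [theta_m] and of its inverse have determinant [q_m ^ 2]. *)
Definition lift_num k z : R[i] :=
  if k.1 then coord1 z - dl k.2 * coord2 z
  else dl k.2 * (coord2 z - dc k.2 * coord1 z) + q2 k.2 * coord1 z.

Definition lift_den k z : R[i] :=
  if k.1 then q2 k.2 * coord2 z + dc k.2 * (coord1 z - dl k.2 * coord2 z)
  else coord2 z - dc k.2 * coord1 z.

(** The factor by which the lift of the coordinates of [z] differs from the
    coordinates of the image; at a point with finite image it is the
    denominator [c z + d]. *)
Definition lift_scale k z : R[i] :=
  if lift_den k z == 0 then lift_num k z else lift_den k z.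

Lemma lift_det k z w :
  lift_num k z * lift_den k w - lift_den k z * lift_num k w
  = q2 k.2 * sdiff z w.
Proof. by rewrite sdiffE /lift_num /lift_den; case: k.1; ring. Qed.

Lemma lift_scale_neq0 k z : lift_scale k z != 0.
Proof.
rewrite /lift_scale; case: ifPn => // /eqP d0; apply/eqP => n0.
have := lift_det k z (fin 0); have := lift_det k z (infty R).
rewrite n0 d0 !mul0r subrr => /esym/eqP.
rewrite mulf_eq0 (negPf (q2_neq0 _)) /=.
move=> /eqP/sdiff_eq0 -> /esym/eqP; rewrite mulf_eq0 (negPf (q2_neq0 _)) /=.
by rewrite oner_eq0.
Qed.

Lemma thetaE k z :
  theta k z = if lift_den k z == 0 then infty R
              else fin (lift_num k z / lift_den k z).
Proof.
have conj0 (a : R[i]) : (a^*%C == 0) = (a == 0).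
  by rewrite -!modulus_eq0 modulus_conj.
rewrite /Defs.theta /lift_den /lift_num; case: k => -[] m /=;
  rewrite /theta_neg /theta_pos; case: z => [a|] /=;
  rewrite ?mulr1 ?mulr0 ?subr0 ?sub0r ?add0r //.
- by rewrite mulr1 conj0 mul1r.
- case: ifPn => // den0; congr Some.
  by move: den0; set dcm := (dc m); clearbody dcm => ?; field.
- rewrite oppr_eq0 conj0; case: ifPn => // d0; congr Some.
  move: d0; rewrite -conj0; set dcm := (dc m); clearbody dcm => ?.
  by field.
Qed.

Lemma coord1_theta k z : lift_num k z = lift_scale k z * coord1 (theta k z).
Proof.
rewrite thetaE /lift_scale; case: ifPn => d0 /=; first by rewrite mulr1.
by rewrite mulrC divfK.
Qed.

Lemma coord2_theta k z : lift_den k z = lift_scale k z * coord2 (theta k z).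
Proof.
rewrite thetaE /lift_scale; case: ifPn => d0 /=; last by rewrite mulr1.
by rewrite mulr0; apply/eqP.
Qed.

Lemma sdiff_theta k z w :
  sdiff (theta k z) (theta k w) * (lift_scale k z * lift_scale k w)
  = q2 k.2 * sdiff z w.
Proof.
rewrite -lift_det !coord1_theta !coord2_theta [in LHS]sdiffE; ring.
Qed.

Lemma sdiff_thetaE k z w :
  sdiff (theta k z) (theta k w)
  = q2 k.2 * sdiff z w / (lift_scale k z * lift_scale k w).
Proof.
by rewrite -sdiff_theta mulfK // mulf_neq0 // lift_scale_neq0.
Qed.

End Moebius.

(** * Ping-pong and freeness *)

Section PingPong.
Variables (R : realType) (M : nat) (delta : 'I_M -> R[i]) (q : 'I_M -> R).
Implicit Types (z : sphere R) (x : R[i]) (k j : letter M) (m : 'I_M).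

Local Notation theta := (theta delta q).
Local Notation act := (act delta q).
Local Notation dl m := (delta m).
Local Notation dc m := ((delta m)^*%C).
Local Notation q2 m := ((q m ^+ 2)%:C : R[i]).

(** The equation of the circle [C_m] as a Hermitian form in homogeneous
    coordinates, which makes sense at infinity and is quadratic along lines. *)
Definition herm m (a b : R[i]) : R :=
  modulus (a - dl m * b) ^+ 2 - q m ^+ 2 * modulus b ^+ 2.

Definition side m z : R := herm m (coord1 z) (coord2 z).

Lemma side_fin m x : side m (fin x) = modulus (x - dl m) ^+ 2 - q m ^+ 2.
Proof. by rewrite /side /herm /= mulr1 modulus1 expr1n mulr1. Qed.

Lemma hermM m c a b : herm m (c * a) (c * b) = modulus c ^+ 2 * herm m a b.
Proof.
rewrite /herm.
have -> : c * a - dl m * (c * b) = c * (a - dl m * b) by ring.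
by rewrite !modulusM; ring.
Qed.

(** Of the two sides of [C_k], the disc meant here is the one onto which
    [theta_k] maps the outside of the disc of [C_{-k}].  For [k = -m] it may
    contain infinity, and it is described as the preimage under [theta_m] of
    the exterior of [C_m]. *)
Definition in_disc k z : bool :=
  if k.1 then 0 < side k.2 (theta_pos delta q k.2 z) else side k.2 z < 0.

Definition in_closed_disc k z : bool :=
  if k.1 then 0 <= side k.2 (theta_pos delta q k.2 z) else side k.2 z <= 0.

Lemma in_disc_closed k z : in_disc k z -> in_closed_disc k z.
Proof. by rewrite /in_disc /in_closed_disc; case: k.1; exact: ltW. Qed.

Hypothesis dom : circular_domain delta q.

Let q_gt0 : forall m, 0 < q m. Proof. by case: dom. Qed.

Let q_ge0 m : 0 <= q m. Proof. exact: ltW (q_gt0 m). Qed.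

Lemma in_disc_theta k z :
  in_disc k (theta k z) = ~~ in_closed_disc (opp_letter k) z.
Proof.
case: k => -[] m; rewrite /in_disc /in_closed_disc /=.
  by rewrite theta_negK // ltNge.
by rewrite ltNge.
Qed.

Lemma in_closed_disc_pos m z : in_closed_disc (false, m) z ->
  exists2 a, z = fin a & closed_disk delta q m a.
Proof.
rewrite /in_closed_disc /side /herm /=; case: z => [a|] /=; last first.
  by rewrite mulr0 subr0 modulus1 modulus0 !expr0n expr1n mulr0 subr0 ler10.
rewrite mulr1 modulus1 expr1n mulr1 subr_le0 => le; exists a => //.
by rewrite /closed_disk /= -(@ler_pXn2r _ 2) ?nnegrE ?modulus_ge0.
Qed.

(** [C_{-m}] is the mirror image of [C_m] in the unit circle. *)
Definition mirror z : R[i] := ((coord2 z / coord1 z)^*)%C.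

Lemma in_closed_disc_neg m z : in_closed_disc (true, m) z ->
  coord1 z != 0 /\ closed_disk delta q m (mirror z).
Proof.
rewrite /in_closed_disc /side /=.
set w := theta_pos delta q m z; set s := lift_scale delta q (false, m) z.
have s0 : s != 0 by exact: lift_scale_neq0.
have -> : (0 <= herm m (coord1 w) (coord2 w)) =
    (modulus (coord2 z - dc m * coord1 z) <= q m * modulus (coord1 z)).
  have s2 : 0 < modulus s ^+ 2 by rewrite exprn_gt0 // modulus_gt0.
  rewrite -(pmulr_rge0 _ s2) -hermM.
  have -> : s * coord1 w = lift_num delta q (false, m) z.
    by rewrite coord1_theta.
  have -> : s * coord2 w = lift_den delta q (false, m) z.
    by rewrite coord2_theta.
  rewrite /herm /lift_num /lift_den /= addrAC subrr add0r modulusM.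
  rewrite modulus_real ?sqr_ge0 // exprMn [_ ^+ 2 ^+ 2]expr2 -mulrA -mulrBr.
  rewrite pmulr_rge0 ?exprn_gt0 // subr_ge0 -exprMn.
  by rewrite ler_pXn2r ?nnegrE ?mulr_ge0 ?modulus_ge0.
move=> le; have c0 : coord1 z != 0.
  apply/eqP => c0; move: le; rewrite c0 mulr0 subr0 modulus0 mulr0.
  by case: (z) c0 => [a|] /= => [_|/eqP]; rewrite ?modulus1 ?ler10 ?oner_eq0.
split=> //; rewrite /closed_disk /= /mirror.
have -> : (coord2 z / coord1 z)^*%C - dl m
    = ((coord2 z - dc m * coord1 z) / coord1 z)^*%C.
  by rewrite mulrBl mulfK // rmorphB /= conjcK.
rewrite modulus_conj modulusM modulusV.
by rewrite ler_pdivrMr ?modulus_gt0.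
Qed.

(** By reflection in the unit circle, the discs of negative index are pairwise
    disjoint as those of positive index are, and lie outside the unit disc,
    which contains the latter. *)
Lemma in_closed_disc_disjoint j k z :
  in_closed_disc j z -> in_closed_disc k z -> j = k.
Proof.
case: dom => _ disj sub.
have disjP i m u : closed_disk delta q i u -> closed_disk delta q m u -> i = m.
  move=> ui um; apply/eqP; apply: contrapT => /negP /disj.
  by move/seteqP => [/(_ u) h _]; exact: h.
have mixed i m : in_closed_disc (false, i) z -> in_closed_disc (true, m) z ->
    False.
  move=> /in_closed_disc_pos[a -> /sub a1] /in_closed_disc_neg[a0] /sub.
  rewrite /unit_disk /mirror /= mul1r modulus_conj modulusV.
  by rewrite invf_lt1 ?modulus_gt0 // ltNge ltW.
case: j k => -[] i [[] m].
- move=> /in_closed_disc_neg[_ zi] /in_closed_disc_neg[_ zm].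
  by rewrite (disjP i m _ zi zm).
- by move=> zi zm; case: (mixed _ _ zm zi).
- by move=> zi zm; case: (mixed _ _ zi zm).
- move=> /in_closed_disc_pos[a -> ai] /in_closed_disc_pos[b [<-] bm].
  by rewrite (disjP _ _ _ ai bm).
Qed.

Lemma D_zeta_outside x k : D_zeta delta q x -> ~~ in_closed_disc k (fin x).
Proof.
case: dom => _ _ sub [x1 xD]; apply/negP; case: k => -[] m.
  move=> /in_closed_disc_neg[x0] /sub.
  rewrite /unit_disk /mirror /= mul1r modulus_conj modulusV.
  by rewrite invf_lt1 ?modulus_gt0 // ltNge ltW.
by move=> /in_closed_disc_pos[a [<-] ax]; apply: xD; exists m.
Qed.

(** Ping-pong: [theta_j] sends everything off the closed disc of [-j] into the
    disc of [j], and the disc of the previous letter is disjoint from that of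
    [-j] because the word is reduced. *)
Lemma act_in_disc x j w : D_zeta delta q x -> reduced (j :: w) ->
  in_disc j (act (j :: w) (fin x)).
Proof.
move=> xD; elim: w j => [|i w IHw] j red.
  by rewrite /= in_disc_theta D_zeta_outside.
have /andP[ij red'] : allowed i j && reduced (i :: w) by [].
change (in_disc j (theta j (act (i :: w) (fin x)))).
rewrite in_disc_theta; apply/negP => /in_closed_disc_disjoint.
move/(_ _ (in_disc_closed (IHw _ red'))) => E.
by move: ij; rewrite /allowed -E /opp_letter /= negbK -surjective_pairing eqxx.
Qed.

Lemma act_moves x j w : D_zeta delta q x -> reduced (j :: w) ->
  act (j :: w) (fin x) <> fin x.
Proof.
move=> xD red E; have := D_zeta_outside j xD.
by rewrite -E in_disc_closed // act_in_disc.
Qed.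

Lemma act_inj w : injective (act w).
Proof.
elim: w => [|k w IHw]; first by move=> ? ?.
by move=> x y /= /(theta_inj q_gt0) /IHw.
Qed.

(** Freeness of the Schottky group: the first letter of a reduced word is read
    off the disc in which the image of a point of the domain lies. *)
Lemma act_reduced_inj x w w' : D_zeta delta q x ->
  reduced w -> reduced w' -> act w = act w' -> w = w'.
Proof.
move=> xD; elim: w w' => [|j w IHw] [|k w'] // red red' E.
- by case: (act_moves xD red'); rewrite -E.
- by case: (act_moves xD red); rewrite E.
have jk : j = k.
  have := act_in_disc xD red; rewrite E => /in_disc_closed.
  move=> /in_closed_disc_disjoint; apply.
  exact/in_disc_closed/(act_in_disc xD).
rewrite -jk in E *; congr (_ :: _); apply: IHw.
- exact: path_sorted red.
- exact: path_sorted red'.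
apply/funext => z; apply: (@theta_inj _ _ delta q q_gt0 j).
exact: (congr1 (fun f => f z) E).
Qed.

End PingPong.

(** * Derivatives at fixed points *)

Section FixedPointDerivative.
Variables (R : realType) (M : nat) (delta : 'I_M -> R[i]) (q : 'I_M -> R).
Hypothesis q_gt0 : forall m, 0 < q m.
Implicit Types (z : sphere R) (k : letter M).

(** The difference quotient of a Moebius map, whose denominator at [h + x] is
    [h * a + b], is [c / ((h * a + b) * b)] with [c] the determinant. *)
Lemma derive1_moebius (K : numFieldType) (f : K -> K^o) (x a b c : K) :
  b != 0 ->
  (forall h, h * a + b != 0 ->
     f (h + x) - f x = h * (c / ((h * a + b) * b))) ->
  derive1 f x = c / b ^+ 2.
Proof.
move=> b0 fE.
have cden : (fun h : K => h * a + b) @ (0 : K) --> b.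
  have : h * a + b @[h --> (0 : K)] --> 0 * a + b.
    exact: (cvgD (cvgM (@cvg_id _ (nbhs (0 : K))) (cvg_cst a)) (cvg_cst b)).
  by rewrite mul0r add0r.
have cquot : (fun h : K => c / ((h * a + b) * b)) @ (0 : K) --> c / b ^+ 2.
  rewrite expr2.
  exact: (cvgM (cvg_cst c) (cvgV (mulf_neq0 b0 b0) (cvgM cden (cvg_cst b)))).
have {}cquot : (fun h : K => c / ((h * a + b) * b)) @ 0^' --> c / b ^+ 2.
  exact: cvg_within_filter.
rewrite /derive1; apply/cvg_lim; first exact: norm_hausdorff.
apply: cvg_trans cquot; apply: near_eq_cvg; near=> h.
have h0 : h != 0 by near: h; exact: nbhs_dnbhs_neq.
have den0 : h * a + b != 0.
  by near: h; apply: nbhs_dnbhs; exact: cvgr_neq0 cden b0.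
by rewrite fE // /GRing.scale /= [RHS]mulrA mulVf ?mul1r.
Unshelve. all: by end_near. Qed.

Lemma derive1_linear (K : numFieldType) (f : K -> K^o) (a : K) :
  (forall t, f t = a * t) -> derive1 f 0 = a.
Proof.
move=> fE; rewrite (@derive1_moebius _ _ _ 0 1 a) ?oner_eq0 ?expr1n ?divr1 //.
by move=> h _; rewrite !fE addr0 !mulr0 add0r mulr1 subr0 divr1 mulrC.
Qed.

(** In homogeneous coordinates the lift of [theta_k] has a fixed point [z] as
    an eigenvector with eigenvalue [lift_scale k z], and the other eigenvalue
    is [q_k ^ 2 / lift_scale k z]; the derivative is their quotient. *)
Lemma fix_deriv_theta k z : theta delta q k z = z ->
  fix_deriv (theta delta q k) z = (q k.2 ^+ 2)%:C / lift_scale delta q k z ^+ 2.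
Proof.
pose Q : R[i] := (q k.2 ^+ 2)%:C.
have Q0 : Q != 0 by exact: q2_neq0.
case: z => [w|] fz /=; last first.
  have d0 : delta k.2 = 0.
    move: fz; rewrite /theta; case: k.1 => /=; first by case: eqP.
    by case: eqP.
  have den0 : lift_den delta q k (infty R) = 0.
    by rewrite /lift_den /= d0 conjc0; case: k.1; ring.
  rewrite /lift_scale den0 eqxx /lift_num /= d0 conjc0 -/Q.
  apply: derive1_linear => t; rewrite /sinv /=.
  case: (eqVneq t 0) => [->|t0]; first by rewrite fz /= mulr0.
  rewrite thetaE /lift_den /lift_num /= d0 conjc0 -/Q; case: k.1.
    rewrite !(mulr1, mul0r, addr0, subr0) (negPf Q0) /=.
    rewrite mulf_eq0 !invr_eq0 (negPf t0) (negPf Q0) /=.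
    by clearbody Q; field; rewrite ?Q0 ?t0.
  rewrite !(mulr1, mul0r, mulr0, addr0, add0r, subr0, divr1) oner_eq0 /=.
  rewrite mulf_eq0 !invr_eq0 (negPf t0) (negPf Q0) /=.
  by clearbody Q; field; rewrite ?Q0 ?t0.
pose den (t : R[i]) := lift_den delta q k (fin t).
have den_affine t h : den (h + t) = h * (den 1 - den 0) + den t.
  by rewrite /den /lift_den /=; case: k.1; ring.
have denw : den w != 0.
  apply/eqP => d0; move: fz; rewrite thetaE -/(den w) d0 eqxx.
  by [].
rewrite (@derive1_moebius _ _ _ (den 1 - den 0) (den w) Q) //.
  by rewrite /lift_scale -/(den w) (negPf denw).
move=> h; rewrite -den_affine => denh.
have scaleE t : den t != 0 -> lift_scale delta q k (fin t) = den t.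
  by move=> dt; rewrite /lift_scale -/(den t) (negPf dt).
have imE t : den t != 0 ->
    theta delta q k (fin t) = fin (to_complex (theta delta q k (fin t))).
  by move=> dt; rewrite thetaE -/(den t) (negPf dt).
have := sdiff_thetaE delta q_gt0 k (fin (h + w)) (fin w).
rewrite (imE _ denh) (imE _ denw) !scaleE //= => ->.
by rewrite addrK -/Q; field; rewrite denh denw.
Qed.

End FixedPointDerivative.

(** * The minimum principle on discs *)

Section MinimumPrinciple.
Variables (R : realType) (M : nat) (delta : 'I_M -> R[i]) (q : 'I_M -> R).
Hypothesis q_gt0 : forall m, 0 < q m.
Implicit Types (p x w : sphere R) (j : letter M) (m : 'I_M).

Local Notation side := (side delta q).
Local Notation herm := (herm delta q).
Local Notation dl m := (delta m).

(** Up to a constant, the modulus of [R_k(w; x)] as a function of [w], with [p]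
    the image of [x] under the inverse of [theta_k]. *)
Definition dist_ratio p x w : R := modulus (sdiff p w) / modulus (sdiff x w).

(** The form [herm] is a real quadratic polynomial along the segment joining two
    vectors, so it vanishes between two vectors on which it has opposite
    signs. *)
Lemma herm_segment m a b c d :
  herm m a b * herm m (a - c) (b - d) < 0 ->
  exists2 t : R, 0 <= t <= 1 & herm m (a - t%:C * c) (b - t%:C * d) = 0.
Proof.
move=> opp.
pose u := a - dl m * b; pose v := c - dl m * d.
pose A := modulus v ^+ 2 - q m ^+ 2 * modulus d ^+ 2.
pose B := complex.Re u * complex.Re v + complex.Im u * complex.Im v
  - q m ^+ 2 * (complex.Re b * complex.Re d + complex.Im b * complex.Im d).
pose P : {poly R} := A *: 'X^2 - (B *+ 2) *: 'X + (herm m a b)%:P.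
have PE (t : R) : P.[t] = herm m (a - t%:C * c) (b - t%:C * d).
  rewrite /P hornerD hornerC hornerD hornerN !hornerZ hornerXn hornerX /herm.
  have -> : a - t%:C * c - dl m * (b - t%:C * d) = u - t%:C * v.
    by rewrite /u /v; ring.
  rewrite -/u /A /B !modulus_sqr; move: (u) (v) => [u1 u2] [v1 v2].
  by case: (b) (d) => b1 b2 [d1 d2] /=; ring.
have P0 : P.[0] = herm m a b by rewrite PE !mul0r !subr0.
have P1 : P.[1] = herm m (a - c) (b - d) by rewrite PE !mul1r.
have [r t01 /rootP rt] : exists2 t : R, 0 <= t <= 1 & root P t.
  have [neg|pos|z] := ltgtP (herm m a b) 0; last by rewrite z mul0r ltxx in opp.
    apply: poly_ivt; rewrite ?ler01 // P0 P1 ltW //=.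
    by move: opp; rewrite nmulr_rlt0 // => /ltW.
  have [t t01 rt] : exists2 t : R, 0 <= t <= 1 & root (- P) t.
    apply: poly_ivt; rewrite ?ler01 // !hornerN P0 P1 oppr_le0 oppr_ge0 ltW //=.
    by move: opp; rewrite pmulr_rlt0 // => /ltW.
  by exists t => //; rewrite -rootN.
by exists r => //; rewrite -PE.
Qed.

(** A minimum principle without complex analysis: the points [w] at which
    [sdiff p w / sdiff x w] is [t] times its value at [w0], for [t] in [0, 1],
    form an arc from [p] to [w0], which crosses the circle if [p] and [w0] lie
    on different sides of it. *)
Lemma circle_crossing m p x w0 : p <> x -> x <> w0 ->
  side m p * side m w0 < 0 ->
  exists2 u, modulus (u - dl m) = q m
           & dist_ratio p x (fin u) <= dist_ratio p x w0.
Proof.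
move=> px xw0 opp.
set X := sdiff x w0; set P := sdiff p w0; set D := sdiff x p.
have X0 : X != 0 by exact: sdiff_neq0.
have D0 : D != 0 by apply: sdiff_neq0 => E; exact: px.
have E1 : X * coord1 p - P * coord1 x = D * coord1 w0.
  by rewrite /X /P /D !sdiffE; ring.
have E2 : X * coord2 p - P * coord2 x = D * coord2 w0.
  by rewrite /X /P /D !sdiffE; ring.
have [t /andP[t0 t1] ht] : exists2 t : R, 0 <= t <= 1 &
    herm m (X * coord1 p - t%:C * (P * coord1 x))
           (X * coord2 p - t%:C * (P * coord2 x)) = 0.
  apply: herm_segment; rewrite E1 E2 !hermM mulrACA pmulr_rlt0 //.
  by rewrite mulr_gt0 // exprn_gt0 // modulus_gt0.
(* [(v1, v2)] is the point of the arc on the circle; it is not at infinity,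
   where the form does not vanish. *)
set v1 := X * _ - _ in ht; set v2 := X * _ - _ in ht.
have Pv : coord1 p * v2 - coord2 p * v1 = t%:C * P * D.
  by rewrite /v1 /v2 /D !sdiffE; ring.
have Xv : coord1 x * v2 - coord2 x * v1 = X * D.
  by rewrite /v1 /v2 /D !sdiffE; ring.
have v20 : v2 != 0.
  apply/eqP => v2E; move: ht; rewrite v2E /herm mulr0 subr0 modulus0 expr0n.
  rewrite mulr0 subr0 => /eqP; rewrite sqrf_eq0 modulus_eq0 => /eqP v1E.
  move/eqP: Xv; rewrite v1E v2E !mulr0 subr0 eq_sym mulf_eq0.
  by rewrite (negPf X0) (negPf D0).
exists (v1 / v2).
  have : herm m (v2 * (v1 / v2)) (v2 * 1) = 0 by rewrite mulr1 mulrC divfK.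
  rewrite hermM => /eqP; rewrite mulf_eq0 sqrf_eq0 modulus_eq0 (negPf v20) /=.
  rewrite /herm mulr1 modulus1 expr1n mulr1 subr_eq0 eqrXn2 ?modulus_ge0 //.
    by move/eqP.
  exact: ltW.
have fE y : sdiff y (fin (v1 / v2)) = (coord1 y * v2 - coord2 y * v1) / v2.
  by rewrite sdiffE /=; field.
rewrite /dist_ratio -/P -/X !fE Pv Xv !modulusM modulusV modulus_real //.
have [nX nD nv] : [/\ 0 < modulus X, 0 < modulus D & 0 < modulus v2].
  by rewrite !modulus_gt0.
have -> : t * modulus P * modulus D * (modulus v2)^-1 /
    (modulus X * modulus D * (modulus v2)^-1) = t * (modulus P / modulus X).
  by field; rewrite !gt_eqF.
by rewrite ler_piMl // divr_ge0 // modulus_ge0.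
Qed.

(** Explicit bounds replace compactness of the circle: the distance from a point
    to it is at least the difference between the distance to its centre and
    its radius. *)
Lemma circle_ratio_bounded m p x : side m p != 0 -> side m x != 0 ->
  exists2 c : R, 0 < c &
    forall u, modulus (u - dl m) = q m -> c <= dist_ratio p x (fin u).
Proof.
move=> sp sx.
have far y : side m y != 0 -> exists2 e : R, 0 < e &
    forall u, modulus (u - dl m) = q m -> e <= modulus (sdiff y (fin u)).
  case: y => [a|] sa; last by exists 1 => // u _ /=; rewrite modulus1.
  exists `|modulus (a - dl m) - q m|.
    rewrite normr_gt0 subr_eq0; apply: contra sa => /eqP E.
    by rewrite side_fin E subrr.
  move=> u uq /=; rewrite ler_norml lerBlDr lerBrDr addrC -uq.
  apply/andP; split.
    have -> : u - dl m = (a - dl m) - (a - u) by ring.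
    by rewrite lerBlDr; apply: le_trans (le_modulusD _ _) _; rewrite modulusN.
  have {1}-> : a - dl m = (a - u) + (u - dl m) by ring.
  exact: le_modulusD.
have near y : exists2 E : R, 0 < E &
    forall u, modulus (u - dl m) = q m -> modulus (sdiff y (fin u)) <= E.
  case: y => [b|]; last by exists 1 => // u _ /=; rewrite modulus1.
  exists (modulus (b - dl m) + q m); first by rewrite ltr_wpDl ?modulus_ge0.
  move=> u uq /=; have -> : b - u = (b - dl m) - (u - dl m) by ring.
  by apply: le_trans (le_modulusD _ _) _; rewrite modulusN uq.
have [e e0 He] := far p sp; have [e' e'0 He'] := far x sx.
have [E E0 HE] := near x.
exists (e / E) => [|u uq]; first exact: divr_gt0.
apply: ler_pM; [exact: ltW|by rewrite invr_ge0 ltW|exact: He|].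
by rewrite lef_pV2 ?posrE ?HE // (lt_le_trans e'0) ?He'.
Qed.

(** Each [sdiff] is multiplied by a factor depending on both its points; the
    factor of [w] cancels. *)
Lemma dist_ratio_theta k p x w :
  dist_ratio (theta delta q k p) (theta delta q k x) (theta delta q k w)
  = modulus (lift_scale delta q k x) / modulus (lift_scale delta q k p)
    * dist_ratio p x w.
Proof.
have sc y : 0 < modulus (lift_scale delta q k y).
  by rewrite modulus_gt0 lift_scale_neq0.
have Q0 : 0 < modulus ((q k.2 ^+ 2)%:C : R[i]).
  by rewrite modulus_gt0 q2_neq0.
rewrite /dist_ratio !sdiff_thetaE // !modulusM !modulusV !modulusM.
have [->|xw] := eqVneq (sdiff x w) 0.
  by rewrite modulus0 mulr0 mul0r !invr0 !mulr0.
have nx : 0 < modulus (sdiff x w) by rewrite modulus_gt0.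
by field; rewrite !gt_eqF.
Qed.

(** For a circle of negative index, [theta_m] maps the circle to [C_m] and its
    disc to the exterior of [C_m], which reduces it to the previous lemmas. *)
Lemma disc_minimum j p x w0 : p <> x ->
  ~~ in_closed_disc delta q j p -> ~~ in_closed_disc delta q j x ->
  in_disc delta q j w0 ->
  (exists2 c : R, 0 < c &
     forall w, circle delta q j w -> c <= dist_ratio p x w) /\
  (exists2 w, circle delta q j w & dist_ratio p x w <= dist_ratio p x w0).
Proof.
have xw0 x' : ~~ in_closed_disc delta q j x' -> in_disc delta q j w0 ->
    x' <> w0.
  by move=> xo /in_disc_closed wi E; rewrite E wi in xo.
move=> px po xo wi; move: (xw0 x xo wi) => {}xw0.
case: j po xo wi => -[] m; rewrite /in_disc /in_closed_disc /= -!ltNge;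
  last first.
  move=> po xo wi; split.
    have [c c0 Hc] := circle_ratio_bounded (lt0r_neq0 po) (lt0r_neq0 xo).
    by exists c => // _ [u uq <-]; exact: Hc.
  have [|u uq le] := @circle_crossing m p x w0 px xw0.
    by rewrite pmulr_rlt0.
  by exists (fin u) => //; exists u.
move=> po xo wi; set T := theta_pos delta q m in po xo wi.
pose kp : letter M := (false, m); pose kn : letter M := (true, m).
have ratioE w : dist_ratio (T p) (T x) (T w) =
    modulus (lift_scale delta q kp x) / modulus (lift_scale delta q kp p)
    * dist_ratio p x w by exact: (dist_ratio_theta kp).
set K := _ / _ in ratioE.
have K0 : 0 < K.
  by rewrite divr_gt0 ?modulus_gt0 ?lift_scale_neq0.
have TK u : T (theta_neg delta q m (fin u)) = fin u by exact: theta_negK.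
have TI := @theta_inj _ _ delta _ q_gt0 kp.
split.
  have [c c0 Hc] := circle_ratio_bounded (ltr0_neq0 po) (ltr0_neq0 xo).
  exists (c / K) => [|_ [_ [u uq <-] <-]]; first exact: divr_gt0.
  by rewrite ler_pdivrMr // mulrC -ratioE TK; exact: Hc.
have [|||u uq le] := @circle_crossing m (T p) (T x) (T w0).
- by move=> /TI.
- by move=> /TI.
- by rewrite nmulr_rlt0.
exists (theta_neg delta q m (fin u)).
  by exists (fin u) => //; exists u.
by rewrite -(ler_pM2l K0) -!ratioE TK.
Qed.

(** The real infimum of a set which is not bounded below is a default value,
    hence the part played by the positive lower bound of the quotient. *)
Lemma inf_circle_le (j : letter M) p x w0 (c : R) (f : sphere R -> R) :
  p <> x ->
  ~~ in_closed_disc delta q j p -> ~~ in_closed_disc delta q j x ->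
  in_disc delta q j w0 -> 0 < c -> (forall w, f w = c * dist_ratio p x w) ->
  inf [set ln (f w) | w in circle delta q j] <= ln (f w0).
Proof.
move=> px po xo wi c0 fE.
have [[e e0 He] [w wj le]] := disc_minimum px po xo wi.
have pos v : circle delta q j v -> 0 < f v.
  by move=> vj; rewrite fE mulr_gt0 // (lt_le_trans e0) ?He.
apply: (@le_trans _ _ (ln (f w))).
  apply: ge_inf; last by exists w.
  exists (ln (c * e)) => _ [v vj <-].
  by rewrite ler_ln ?posrE ?pos ?mulr_gt0 // fE ler_pM2l // He.
have le' : f w <= f w0 by rewrite !fE ler_pM2l.
have fw := pos _ wj.
by rewrite ler_ln ?posrE // (lt_le_trans fw).
Qed.

End MinimumPrinciple.

(** * The increment of the potential along an edge *)

Section PotentialIncrement.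
Variables (R : realType) (M : nat) (delta : 'I_M -> R[i]) (q : 'I_M -> R).
Variables (zeta alpha : R[i]) (zfix : letter M -> sphere R).
Hypothesis dom : circular_domain delta q.
Hypothesis zetaD : D_zeta delta q zeta.
Hypothesis alphaD : D_zeta delta q alpha.
Hypothesis zeta_alpha : zeta != alpha.
Hypothesis zfixP : forall k, theta delta q k (zfix k) = zfix k.
Implicit Types (a b p z : sphere R) (x : R[i]) (j k : letter M) (w : word M).

Local Notation theta := (theta delta q).
Local Notation act := (act delta q).
Local Notation scale := (lift_scale delta q).
Local Notation U w := (U_pot zeta alpha (act w)).

Let q_gt0 : forall m, 0 < q m. Proof. by case: dom. Qed.

(** As a function of the images [a] of [zeta] and [b] of [alpha], the number
    [R(theta) - 1] is itself a cross ratio. *)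
Definition pair_ratio a b : R[i] :=
  (sdiff a b * sdiff (fin alpha) (fin zeta))
    / (sdiff a (fin zeta) * sdiff b (fin alpha)).

Lemma R_pot_sub1 f : f (fin zeta) <> fin zeta -> f (fin alpha) <> fin alpha ->
  R_pot zeta alpha f - 1 = pair_ratio (f (fin zeta)) (f (fin alpha)).
Proof.
move=> /sdiff_neq0 z0 /sdiff_neq0 a0; rewrite /R_pot /pair_ratio.
rewrite -[X in _ - X](divff (mulf_neq0 z0 a0)) -mulrBl; congr (_ / _).
by rewrite !sdiffE /=; ring.
Qed.

Lemma pair_ratio_neq0 a b : a <> b -> a <> fin zeta -> b <> fin alpha ->
  pair_ratio a b != 0.
Proof.
move=> ab az ba; rewrite !mulf_neq0 ?invr_neq0 ?mulf_neq0 ?sdiff_neq0 //.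
by move=> [/eqP]; rewrite eq_sym (negPf zeta_alpha).
Qed.

(** Moving [zeta] and [alpha] by [theta_k^-1] instead of moving [a] and [b] by
    [theta_k] compares the two cross ratios; the factors which appear are those
    of the edge weight, the derivative being [q_k ^ 2 / scale ^ 2] at the fixed
    point. *)
Lemma pair_ratio_theta k a b : a <> b ->
  a <> fin zeta -> b <> fin alpha ->
  theta k a <> fin zeta -> theta k b <> fin alpha ->
  zfix k <> fin zeta -> zfix k <> fin alpha ->
  pair_ratio a b * fix_deriv (theta k) (zfix k)
  = pair_ratio (theta k a) (theta k b)
    * R_edge delta q zfix k a zeta * R_edge delta q zfix k b alpha.
Proof.
move=> ab az ba Taz Tba fz fa.
rewrite (fix_deriv_theta q_gt0 (zfixP k)) /R_edge /cross_ratio /pair_ratio.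
have opp_inv z : theta k (theta (opp_letter k) z) = z by exact: theta_oppK.
set p := theta (opp_letter k) (fin zeta).
set r := theta (opp_letter k) (fin alpha).
have pz : theta k p = fin zeta by exact: opp_inv.
have ra : theta k r = fin alpha by exact: opp_inv.
have Q0 := q2_neq0 q_gt0 k.2.
have sc z : scale k z != 0 by exact: lift_scale_neq0.
have E1 := sdiff_thetaE delta q_gt0 k a b.
have E2 := sdiff_thetaE delta q_gt0 k a p.
have E3 := sdiff_thetaE delta q_gt0 k b r.
have E4 := sdiff_thetaE delta q_gt0 k p (zfix k).
have E5 := sdiff_thetaE delta q_gt0 k r (zfix k).
rewrite pz in E2; rewrite ra in E3.
rewrite pz zfixP in E4; rewrite ra zfixP in E5.
have n1 := sdiff_neq0 ab; have n2 := sdiff_neq0 az.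
have n3 := sdiff_neq0 ba.
have n4 : sdiff a p != 0.
  by apply: sdiff_neq0 => ap; apply: Taz; rewrite ap pz.
have n5 : sdiff b r != 0.
  by apply: sdiff_neq0 => br; apply: Tba; rewrite br ra.
have n6 : sdiff p (zfix k) != 0.
  by apply: sdiff_neq0 => pf; apply: fz; rewrite -zfixP -pf pz.
have n7 : sdiff r (zfix k) != 0.
  by apply: sdiff_neq0 => rf; apply: fa; rewrite -zfixP -rf ra.
rewrite E1 E2 E3 E4 E5.
rewrite [sdiff p a]sdiffC [sdiff (fin zeta) a]sdiffC.
rewrite [sdiff r b]sdiffC [sdiff (fin alpha) b]sdiffC.
move: (sc a) (sc b) (sc p) (sc r) (sc (zfix k)) Q0 n1 n2 n3 n4 n5 n6 n7.
move: (sdiff a b) (sdiff a (fin zeta)) (sdiff b (fin alpha)).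
move: (sdiff a p) (sdiff b r) (sdiff p (zfix k)) (sdiff r (zfix k)).
move: (scale k a) (scale k b) (scale k p) (scale k r) (scale k (zfix k)).
move: ((q k.2 ^+ 2)%:C : R[i]) (sdiff (fin alpha) (fin zeta)).
clear; move=> Q S la lb lp lr lf ap br pf rf ab az ba *.
by field; do !(apply/andP; split).
Qed.

Lemma modulus_R_edge k z x :
  modulus (R_edge delta q zfix k z x) =
    modulus (sdiff (fin x) (zfix k))
      / modulus (sdiff (theta (opp_letter k) (fin x)) (zfix k))
    * dist_ratio (theta (opp_letter k) (fin x)) (fin x) z.
Proof.
rewrite /R_edge /cross_ratio /dist_ratio !modulusM modulusV !modulusM.
by rewrite [X in X / _]mulrC invfM mulrACA.
Qed.

Lemma zfix_outside k x : D_zeta delta q x -> zfix k <> fin x.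
Proof.
move=> xD E; have := zfixP k; rewrite E.
exact: (act_moves dom (w := [::])).
Qed.

(** [x] is one of the two base points.  The zero [theta_k^-1 x] of the edge
    factor lies in the disc of [-k], distinct from that of [j] as the edge is
    allowed, and its pole [x] lies in no disc; so the minimum principle applies
    to the disc of [j]. *)
Lemma inf_R_edge_le j k z x : D_zeta delta q x -> allowed j k ->
  in_disc delta q j z ->
  0 < modulus (R_edge delta q zfix k z x) /\
  inf [set ln (modulus (R_edge delta q zfix k w x)) | w in circle delta q j]
    <= ln (modulus (R_edge delta q zfix k z x)).
Proof.
move=> xD jk zj; set p := theta (opp_letter k) (fin x).
have pk : in_disc delta q (opp_letter k) p.
  by rewrite (in_disc_theta dom) (D_zeta_outside dom).
have xo i : ~~ in_closed_disc delta q i (fin x) by exact: D_zeta_outside.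
have po : ~~ in_closed_disc delta q j p.
  apply/negP => /(in_closed_disc_disjoint dom (in_disc_closed pk)) E.
  move: jk; rewrite /allowed -E /opp_letter /= negbK.
  by rewrite -surjective_pairing eqxx.
have px : p <> fin x.
  by move=> E; move: (xo (opp_letter k)); rewrite -E in_disc_closed.
have out p' : ~~ in_closed_disc delta q j p' -> p' <> z.
  by move=> yo E; rewrite E in_disc_closed in yo.
have c0 : 0 < modulus (sdiff (fin x) (zfix k)) / modulus (sdiff p (zfix k)).
  rewrite divr_gt0 // modulus_gt0 sdiff_neq0 //.
    by move=> E; exact: (zfix_outside (k := k) xD).
  move=> E; apply: (zfix_outside (k := k) xD).
  by rewrite -zfixP -E /p theta_oppK.
split; last first.
  apply: (inf_circle_le q_gt0 px po (xo j) zj c0) => z'.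
  exact: modulus_R_edge.
rewrite modulus_R_edge mulr_gt0 // divr_gt0 // modulus_gt0 sdiff_neq0 //.
  exact: out.
exact: out.
Qed.

Lemma U_potE w : w != [::] -> reduced w ->
  pair_ratio (act w (fin zeta)) (act w (fin alpha)) != 0 /\
  U w = - ln (modulus (pair_ratio (act w (fin zeta)) (act w (fin alpha)))).
Proof.
case: w => // j w _ red.
have mz := act_moves dom zetaD red; have ma := act_moves dom alphaD red.
split; last by rewrite /U_pot R_pot_sub1.
apply: pair_ratio_neq0 => // /(act_inj dom) [/eqP].
by rewrite (negPf zeta_alpha).
Qed.

Lemma U_edge_increment j k w : reduced [:: k, j & w] ->
  U (j :: w) + Delta_lb delta q zeta alpha zfix j k <= U [:: k, j & w].
Proof.
move=> red; have /andP[jk red'] : allowed j k && reduced (j :: w) by [].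
have [P0 ->] := @U_potE (j :: w) isT red'.
have [P'0 ->] := @U_potE [:: k, j & w] isT red.
have mz := act_moves dom zetaD red'; have ma := act_moves dom alphaD red'.
have mz' := act_moves dom zetaD red; have ma' := act_moves dom alphaD red.
have dz := act_in_disc dom zetaD red'; have da := act_in_disc dom alphaD red'.
set a := act (j :: w) (fin zeta) in P0 mz dz *.
set b := act (j :: w) (fin alpha) in P0 ma da *.
have -> : act [:: k, j & w] (fin zeta) = theta k a by [].
have -> : act [:: k, j & w] (fin alpha) = theta k b by [].
have ab : a <> b.
  by move=> /(act_inj dom) [/eqP]; rewrite (negPf zeta_alpha).
have [Rz0 infz] := inf_R_edge_le zetaD jk dz.
have [Ra0 infa] := inf_R_edge_le alphaD jk da.
have := pair_ratio_theta ab mz ma mz' ma' (zfix_outside (k := k) zetaD)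
  (zfix_outside (k := k) alphaD).
move/(congr1 (fun x => ln (modulus x))); rewrite (modulusM (pair_ratio a b)).
rewrite (modulusM (pair_ratio _ _ * _)) (modulusM (pair_ratio _ _)).
have D0 : 0 < modulus (fix_deriv (theta k) (zfix k)).
  rewrite modulus_gt0 (fix_deriv_theta q_gt0 (zfixP k)).
  by rewrite mulf_neq0 ?invr_neq0 ?expf_neq0 ?q2_neq0 ?lift_scale_neq0.
rewrite -modulus_gt0 in P0; rewrite -modulus_gt0 in P'0.
rewrite !lnM ?posrE ?mulr_gt0 //.
by rewrite /Delta_lb; lra.
Qed.

(** ** Words below a cutoff *)

Lemma U_le_expR w u : w != [::] -> reduced w ->
  (U w <= u) = ((expR u)^-1 <= modulus (R_pot zeta alpha (act w) - 1)).
Proof.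
move=> w0 red; have [P0 _] := U_potE w0 red.
case: w w0 red P0 => // j w _ red P0.
have mz := act_moves dom zetaD red; have ma := act_moves dom alphaD red.
rewrite /U_pot R_pot_sub1 // lerNl; set r := modulus _.
have r0 : r \is Num.pos by rewrite posrE modulus_gt0.
by rewrite -expRN -[X in _ = (_ <= X)](lnK r0) ler_expR.
Qed.

(** Distinct reduced words being distinct maps, a finite set of maps counts the
    words below the corresponding cutoff. *)
Lemma words_below u T : expR u <= T ->
  (0 < pollicott_count delta q zeta alpha T)%N ->
  exists2 L : seq (word M),
    (size L <= pollicott_count delta q zeta alpha T)%N &
    forall w, w != [::] -> reduced w -> U w <= u -> w \in L.
Proof.
rewrite /pollicott_count; set S := [set f | _] => uT count0.
have finS : finite_set S.
  (* An infinite set would be given the cardinal zero. *)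
  by move: count0; rewrite /fset_set; case: pselect => // _; rewrite cardfs0.
pose pick f : word M := xget [::] [set w | reduced w /\ act w = f].
exists [seq pick f | f <- fset_set S]; first by rewrite size_map.
move=> w w0 red Uw; have -> : w = pick (act w).
  rewrite /pick; case: xgetP => [v _ [rv E]|/(_ w)[]//].
  exact: (act_reduced_inj dom zetaD).
apply: map_f; rewrite in_fset_set //; apply/mem_set; split; first by exists w.
  case: w w0 red {Uw} => // j w _ red E.
  by apply: (act_moves dom zetaD red); rewrite E.
move: Uw; rewrite U_le_expR //; apply: le_trans.
by rewrite lef_pV2 ?posrE ?expR_gt0 // (lt_le_trans (expR_gt0 u)).
Qed.

End PotentialIncrement.

(** * Correctness and complexity of the enumeration *)

Theorem proposition6p3 (R : realType) (M : nat) (delta : 'I_M -> R[i])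
    (q : 'I_M -> R) (zeta alpha : R[i]) (zfix : letter M -> sphere R)
    (C d : R) :
  (1 <= M)%N ->
  circular_domain delta q ->
  D_zeta delta q zeta ->
  D_zeta delta q alpha ->
  zeta != alpha ->
  (forall k, theta delta q k (zfix k) = zfix k) ->
  0 < C ->
  0 < d < 2 ->
  hausdorff_dim (limit_set delta q) = d%:E ->
  (pollicott_count delta q zeta alpha T)%:R / (C * T `^ d)
    @[T --> +oo] --> (1 : R) ->
  let wt := Delta_lb delta q zeta alpha zfix in
  let Wmin := min_walk_weight wt in
  ~ has_negative_cycle wt ->
  (forall Umax : R, 0 < Umax ->
     terminates delta q zeta alpha Umax wt /\
     forall s, returns delta q zeta alpha Umax wt s ->
       set_bij `I_(size (output s)) (Theta''_le delta q zeta alpha Umax)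
         (fun i => act delta q (nth [::] (output s) i))) /\
  (exists2 K : R, 0 < K & \forall Umax \near +oo,
     forall s, returns delta q zeta alpha Umax wt s ->
       (size (visited s))%:R <= K * expR (d * (Umax - Wmin))).
Proof.
move=> _ dom zetaD alphaD za zfixP C0 /andP[d0 _] _ asym wt Wmin no_neg.
have W0 : Wmin <= 0.
  by rewrite -(walk_weight_nil wt) min_walk_weight_le.
have Wle s : sorted (@allowed M) s -> Wmin <= walk_weight wt s.
  by move=> ws; exact: min_walk_weight_le.
have U_edge := U_edge_increment dom zetaD alphaD za zfixP.
have run_W Umax s : returns delta q zeta alpha Umax wt s ->
    clos_refl_trans _ (step delta q zeta alpha Umax Wmin)
      (init_state M zeta alpha) s /\ stack s = [::].
  by case=> W; rewrite (bellman_ford_min no_neg) => -[<-].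
have [T0 count_near] : exists T0 : R, forall T, T0 < T ->
    (0 < pollicott_count delta q zeta alpha T)%N /\
    (pollicott_count delta q zeta alpha T)%:R <= 2 * C * T `^ d.
  have [T0 [_ T0P]] : \forall T \near +oo,
      0 < (pollicott_count delta q zeta alpha T)%:R / (C * T `^ d) < 2.
    near=> T; apply/andP; split; near: T.
      exact: cvgr_gt asym _ ltr01.
    by apply: cvgr_lt asym _ _; rewrite ltr1n.
  exists (Num.max T0 0) => T; rewrite gt_max => /andP[T0T T_gt0].
  have pos : 0 < C * T `^ d by rewrite mulr_gt0 // powR_gt0.
  have /andP[] := T0P _ T0T; rewrite ltr_pdivrMr // => lo /ltW up; split.
    by rewrite -(ltr0n R) -(pmulr_lgt0 _ (_ : 0 < (C * T `^ d)^-1)) ?invr_gt0.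
  by rewrite -mulrA.
split=> [Umax Umax0|].
  split.
    exists Wmin; first exact: bellman_ford_min.
    (* The asymptotics tell that the set counted at [T] is finite only for large
       [T], but these sets grow with [T]. *)
    pose T := Num.max (expR (Umax - Wmin)) (T0 + 1).
    have eT : expR (Umax - Wmin) <= T by rewrite le_max lexx.
    have [|count0 _] := count_near T; first by rewrite lt_max ltrDl ltr01 orbT.
    have [L _ LP] := words_below dom zetaD alphaD za eT count0.
    apply: (@search_terminates _ _ _ _ _ _ _ _ (\max_(w <- L) size w)) => w rw.
    rewrite ltnNge ltNge; apply: contra => Uw.
    case: w rw Uw => // j w rw Uw.
    have jL : j :: w \in L by exact: LP.
    exact: (leq_bigmax_seq (P := xpredT) (F := size) _ jL isT).
  move=> s /run_W[run S0].
  have outE w := mem_output Wle U_edge w W0 run S0.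
  have [un _ outV] := search_result run S0.
  have uo : uniq (output s) by rewrite outV filter_uniq.
  split.
  - move=> i /= i_lt; have := mem_nth [::] i_lt; rewrite outE.
    by case/and4P => w0 rw cw Uw; split=> //; exists (nth [::] (output s) i).
  - move=> i i' /set_mem i_lt /set_mem i'_lt E; apply/eqP.
    rewrite -(nth_uniq [::] i_lt i'_lt uo); apply/eqP.
    have := mem_nth [::] i_lt; have := mem_nth [::] i'_lt; rewrite !outE.
    case/and4P => _ rw' _ _ /and4P[_ rw _ _].
    exact: (act_reduced_inj dom zetaD rw rw' E).
  - move=> f [[w [w0 rw cw] <-] Uw].
    have wO : w \in output s by rewrite outE w0 rw cw Uw.
    exists (index w (output s)); rewrite /= ?index_mem // nth_index //.
pose m : R := (2 * M)%:R; have m0 : 0 <= m by rewrite ler0n.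
(* The number of visited words is at most [1 + m * (1 + N)], with [N] the number
   of maps counted at [expR (Umax - Wmin)]. *)
exists (1 + m + m * (2 * C)).
  by rewrite ltr_wpDr ?mulr_ge0 ?(ltW C0) // ltr_wpDr.
near=> Umax => s /run_W[run S0].
have x0 : 0 <= Umax - Wmin by rewrite subr_ge0 (le_trans W0).
have [count0 count_le] :
    (0 < pollicott_count delta q zeta alpha (expR (Umax - Wmin)))%N /\
    (pollicott_count delta q zeta alpha (expR (Umax - Wmin)))%:R
      <= 2 * C * expR (d * (Umax - Wmin)).
  rewrite [d * _]mulrC expRM; apply: count_near.
  apply: lt_le_trans (expR_ge1Dx _).
  have : T0 < Umax by near: Umax; apply: nbhs_pinfty_gt; exact: num_real.
  lra.
have [L sL LP] := words_below dom zetaD alphaD za (lexx _) count0.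
have := size_visited LP run S0.
rewrite -(ler_nat R) => /le_trans; apply.
rewrite natrD natrM natrD -/m.
have e1 : 1 <= expR (d * (Umax - Wmin)).
  by rewrite -expR0 ler_expR mulr_ge0 // ltW.
have L_le : (size L)%:R <= 2 * C * expR (d * (Umax - Wmin)).
  by apply: le_trans count_le; rewrite ler_nat.
have : m * (size L)%:R <= m * (2 * C * expR (d * (Umax - Wmin))).
  exact: ler_wpM2l.
have : (1 + m) * 1 <= (1 + m) * expR (d * (Umax - Wmin)).
  by apply: ler_wpM2l => //; rewrite addr_ge0.
set e := expR _; lra.
Unshelve. all: by end_near. Qed.
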